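(* A weakly o-minimal type $p\in S(A)$ has simple semiintervals if and only if some weakly o-minimal pair $\mathbf p=(p,<)$ over $A$ has simple semiintervals.
   Context: $T$ is an arbitrary (possibly multi-sorted) complete first-order theory with monster model $\mathfrak C$; $A$ is a small parameter set. For a complete type $p\in S(A)$, $p(\mathfrak C)$ is its set of realizations; a set $X\subseteq p(\mathfrak C)^n$ is relatively $B$-definable if $X=\phi(\mathfrak C)\cap p(\mathfrak C)^n$ for some $L_B$-formula $\phi$, and relatively definable if it is so for some $B$. A weakly o-minimal pair over $A$ is $\mathbf p=(p,<)$ where $p\in S(A)$, $<$ is a relatively $A$-definable linear order on $p(\mathfrak C)$, and every relatively definable subset of $p(\mathfrak C)$ is a finite union of $<$-convex subsets of $p(\mathfrak C)$. A type $p\in S(A)$ is weakly o-minimal if there is a weakly o-minimal pair $(p,<)$ over $A$. $\mathcal E_p$ is the set of all relatively $A$-definable equivalence relations on $p(\mathfrak C)$. A $\mathbf p$-semiinterval is a convex subset $S$ of $(p(\mathfrak C),<)$ such that $a=\min S$ exists and $S$ is relatively $Aa$-definable within $p(\mathfrak C)$. It is $\mathcal E_p$-determined if $S=\{x\in[a]_E\mid a\leqslant x\}$ for some $E\in\mathcal E_p$. The pair $\mathbf p$ has simple semiintervals if every $\mathbf p$-semiinterval is $\mathcal E_p$-determined. The type $p$ has simple semiintervals if every weakly o-minimal pair $(p,<_p)$ over $A$ has simple semiintervals. *)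

(* Defs.v *)
From mathcomp Require Import all_boot.
From mathcomp Require Import boolp classical_sets functions cardinality.

Set Implicit Arguments.
Unset Strict Implicit.
Unset Printing Implicit Defensive.

Local Open Scope classical_set_scope.
Local Open Scope card_scope.

(** Syntax is intrinsically sorted and scoped: a context is the list of the
    sorts of the free variables, and [All] binds the head of the context. *)

Record language := Language {
  sorts : Type;
  funs : Type;
  fdom : funs -> seq sorts;
  fcod : funs -> sorts;
  rels : Type;
  rdom : rels -> seq sorts }.

Inductive var (S : Type) : seq S -> S -> Type :=
| VHead (s : S) (G : seq S) : var (s :: G) s
| VTail (s s' : S) (G : seq S) : var G s -> var (s' :: G) s.

Inductive term (L : language) (G : seq (sorts L)) : sorts L -> Type :=
| Var (s : sorts L) : var G s -> term G s
| App (f : funs L) : terms G (fdom f) -> term G (fcod f)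
with terms (L : language) (G : seq (sorts L)) : seq (sorts L) -> Type :=
| TNil : terms G [::]
| TCons (s : sorts L) (D : seq (sorts L)) :
    term G s -> terms G D -> terms G (s :: D).

Inductive formula (L : language) : seq (sorts L) -> Type :=
| Bot (G : seq (sorts L)) : formula G
| Eq (G : seq (sorts L)) (s : sorts L) : term G s -> term G s -> formula G
| Rel (G : seq (sorts L)) (r : rels L) : terms G (rdom r) -> formula G
| Imp (G : seq (sorts L)) : formula G -> formula G -> formula G
| All (G : seq (sorts L)) (s : sorts L) : formula (s :: G) -> formula G.

Definition Neg (L : language) (G : seq (sorts L)) (f : formula G) : formula G :=
  Imp f (Bot G).

Fixpoint tup (S : Type) (M : S -> Type) (G : seq S) : Type :=
  if G is s :: G' then (M s * tup M G')%type else unit.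

Fixpoint tup_cat (S : Type) (M : S -> Type) (G D : seq S) :
    tup M G -> tup M D -> tup M (G ++ D) :=
  match G return tup M G -> tup M D -> tup M (G ++ D) with
  | [::] => fun _ b => b
  | s :: G' => fun a b => (a.1, tup_cat a.2 b)
  end.

Fixpoint tup_map (S : Type) (M N : S -> Type) (h : forall s, M s -> N s)
    (G : seq S) : tup M G -> tup N G :=
  match G return tup M G -> tup N G with
  | [::] => fun a => a
  | s :: G' => fun a => (h s a.1, tup_map h a.2)
  end.

Record structure (L : language) := Structure {
  carrier :> sorts L -> Type;
  fint : forall f : funs L, tup carrier (fdom f) -> carrier (fcod f);
  rint : forall r : rels L, tup carrier (rdom r) -> Prop }.

Fixpoint lookup (S : Type) (M : S -> Type) (G : seq S) (s : S) (v : var G s) :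
    tup M G -> M s :=
  match v in var G s return tup M G -> M s with
  | VHead _ _ => fun a => a.1
  | VTail _ _ _ v' => fun a => lookup v' a.2
  end.

Fixpoint eval (L : language) (M : structure L) (G : seq (sorts L))
    (a : tup M G) (s : sorts L) (t : term G s) : M s :=
  match t in term _ s return M s with
  | Var _ v => lookup v a
  | App f ts => fint (evals a ts)
  end
with evals (L : language) (M : structure L) (G : seq (sorts L))
    (a : tup M G) (D : seq (sorts L)) (ts : terms G D) : tup M D :=
  match ts in terms _ D return tup M D with
  | TNil => tt
  | TCons _ _ t ts' => (eval a t, evals a ts')
  end.

Fixpoint sat (L : language) (M : structure L) (G : seq (sorts L))
    (f : formula G) : tup M G -> Prop :=
  match f in formula G return tup M G -> Prop with
  | Bot _ => fun _ => False
  | Eq _ _ t u => fun a => eval a t = eval a u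
  | Rel _ _ ts => fun a => rint (evals a ts)
  | Imp _ f1 f2 => fun a => sat f1 a -> sat f2 a
  | All _ s f1 => fun a => forall x : M s, sat f1 ((x, a) : tup M (s :: _))
  end.

Definition theory (L : language) := set (@formula L [::]).

Definition models (L : language) (M : structure L) (T : theory L) : Prop :=
  forall f, T f -> sat f (tt : tup M [::]).

Definition entails (L : language) (T : theory L) (f : @formula L [::]) : Prop :=
  forall M : structure L, models M T -> sat f (tt : tup M [::]).

Definition complete_theory (L : language) (T : theory L) : Prop :=
  (exists M : structure L, models M T) /\
  (forall f, entails T f \/ entails T (Neg f)).

Record automorphism (L : language) (M : structure L)
    (h : forall s, M s -> M s) : Prop := {
  aut_bij : forall s, bijective (h s);
  aut_fun : forall (f : funs L) (a : tup M (fdom f)),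
    h _ (fint a) = fint (tup_map h a);
  aut_rel : forall (r : rels L) (a : tup M (rdom r)),
    rint a <-> rint (tup_map h a) }.

Definition elt (L : language) (M : structure L) : Type := {s : sorts L & M s}.

Fixpoint entries (L : language) (M : structure L) (G : seq (sorts L)) :
    tup M G -> set (elt M) :=
  match G return tup M G -> set (elt M) with
  | [::] => fun _ => set0
  | s :: G' => fun a => existT _ s a.1 |` entries a.2
  end.

(** An L_A-formula in the free variables [G] is f(x, b) with f an L-formula
    and b a finite tuple from A. *)
Record pformula (L : language) (M : structure L) (A : set (elt M))
    (G : seq (sorts L)) := PFormula {
  pctx : seq (sorts L);
  pfml : formula (G ++ pctx);
  ppar : tup M pctx;
  ppar_in : entries ppar `<=` A }.

Definition pneg (L : language) (M : structure L) (A : set (elt M))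
    (G : seq (sorts L)) (f : pformula A G) : pformula A G :=
  PFormula (Neg (pfml f)) (@ppar_in _ _ _ _ f).

Definition holds (L : language) (M : structure L) (A : set (elt M))
    (G : seq (sorts L)) (f : pformula A G) (a : tup M G) : Prop :=
  sat (pfml f) (tup_cat a (ppar f)).

Definition realizations (L : language) (M : structure L) (A : set (elt M))
    (G : seq (sorts L)) (p : set (pformula A G)) : set (tup M G) :=
  [set a | forall f, p f -> holds f a].

Definition finitely_satisfiable (L : language) (M : structure L)
    (A : set (elt M)) (G : seq (sorts L)) (p : set (pformula A G)) : Prop :=
  forall q : set (pformula A G),
    finite_set q -> q `<=` p -> realizations q !=set0.

Definition complete_type (L : language) (M : structure L) (A : set (elt M))
    (G : seq (sorts L)) (p : set (pformula A G)) : Prop :=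
  finitely_satisfiable p /\ (forall f, p f \/ p (pneg f)).

(** The cardinal kappa is given as the cardinality of a type [K]; small means
    of cardinality < kappa. *)

Definition card_ltT (U K : Type) (X : set U) : Prop :=
  (X #<= [set: K]) /\ ~ ([set: K] #<= X).

Definition small (K : Type) (L : language) (M : structure L)
    (A : set (elt M)) : Prop := card_ltT K A.

Definition saturated (K : Type) (L : language) (M : structure L) : Prop :=
  forall (A : set (elt M)) (G : seq (sorts L)) (p : set (pformula A G)),
    small K A -> finitely_satisfiable p -> realizations p !=set0.

(** The partial map is the restriction of [h] to [A]. *)
Definition elementary_on (L : language) (M : structure L) (A : set (elt M))
    (h : forall s, M s -> M s) : Prop :=
  forall (G : seq (sorts L)) (f : formula G) (a : tup M G),
    entries a `<=` A -> (sat f a <-> sat f (tup_map h a)).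

Definition strongly_homogeneous (K : Type) (L : language) (M : structure L) :
    Prop :=
  forall (A : set (elt M)) (h : forall s, M s -> M s),
    small K A -> elementary_on A h ->
    exists g : forall s, M s -> M s,
      automorphism g /\ (forall s (x : M s), A (existT _ s x) -> g s x = h s x).

(** [monster_large] says kappa > |L| + aleph_0, since this is the number of
    L-formulas. *)
Record monster (K : Type) (L : language) (T : theory L) (M : structure L) :
    Prop := {
  monster_models : models M T;
  monster_large : card_ltT K [set: {G : seq (sorts L) & formula G}];
  monster_saturated : saturated K M;
  monster_homogeneous : strongly_homogeneous K M }.

(** Subsets and binary relations are predicates on all tuples; only their
    traces on [realizations p] are meaningful. *)

Definition rel_definable_over (L : language) (M : structure L)
    (A : set (elt M)) (G : seq (sorts L)) (p : set (pformula A G))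
    (B : set (elt M)) (X : set (tup M G)) : Prop :=
  exists f : pformula B G,
    forall a, realizations p a -> (X a <-> holds f a).

Definition rel_definable (L : language) (M : structure L)
    (A : set (elt M)) (G : seq (sorts L)) (p : set (pformula A G))
    (X : set (tup M G)) : Prop :=
  exists B : set (elt M), rel_definable_over p B X.

Definition rel_definable_over2 (L : language) (M : structure L)
    (A : set (elt M)) (G : seq (sorts L)) (p : set (pformula A G))
    (B : set (elt M)) (R : tup M G -> tup M G -> Prop) : Prop :=
  exists f : pformula B (G ++ G),
    forall a b, realizations p a -> realizations p b ->
      (R a b <-> holds f (tup_cat a b)).

Definition linear_order_on (U : Type) (D : set U) (lt : U -> U -> Prop) :
    Prop :=
  [/\ forall x, D x -> ~ lt x x,
      forall x y z, D x -> D y -> D z -> lt x y -> lt y z -> lt x z &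
      forall x y, D x -> D y -> [\/ lt x y, x = y | lt y x]].

Definition equivalence_on (U : Type) (D : set U) (E : U -> U -> Prop) : Prop :=
  [/\ forall x, D x -> E x x,
      forall x y, D x -> D y -> E x y -> E y x &
      forall x y z, D x -> D y -> D z -> E x y -> E y z -> E x z].

Definition convex_in (U : Type) (D : set U) (lt : U -> U -> Prop) (X : set U) :
    Prop :=
  X `<=` D /\
  (forall x y z, X x -> X y -> D z -> lt x z -> lt z y -> X z).

Record wom_pair (L : language) (M : structure L) (A : set (elt M))
    (G : seq (sorts L)) (p : set (pformula A G))
    (lt : tup M G -> tup M G -> Prop) : Prop := {
  wom_order : linear_order_on (realizations p) lt;
  wom_definable : rel_definable_over2 p A lt;
  wom_convex : forall X : set (tup M G),
    X `<=` realizations p -> rel_definable p X ->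
    exists F : set (set (tup M G)),
      [/\ finite_set F,
          forall Y, F Y -> convex_in (realizations p) lt Y &
          X = \bigcup_(Y in F) Y] }.

Definition wom_type (L : language) (M : structure L) (A : set (elt M))
    (G : seq (sorts L)) (p : set (pformula A G)) : Prop :=
  exists lt, wom_pair p lt.

Definition def_equivalence (L : language) (M : structure L) (A : set (elt M))
    (G : seq (sorts L)) (p : set (pformula A G))
    (E : tup M G -> tup M G -> Prop) : Prop :=
  equivalence_on (realizations p) E /\ rel_definable_over2 p A E.

Definition is_min (U : Type) (lt : U -> U -> Prop) (X : set U) (a : U) : Prop :=
  X a /\ (forall x, X x -> a = x \/ lt a x).

(** [semiinterval p lt S a]: S is a semiinterval of (p, lt) and a = min S. *)
Definition semiinterval (L : language) (M : structure L) (A : set (elt M))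
    (G : seq (sorts L)) (p : set (pformula A G))
    (lt : tup M G -> tup M G -> Prop) (S : set (tup M G)) (a : tup M G) :
    Prop :=
  [/\ convex_in (realizations p) lt S,
      is_min lt S a &
      rel_definable_over p (A `|` entries a) S].

Definition determined (L : language) (M : structure L) (A : set (elt M))
    (G : seq (sorts L)) (p : set (pformula A G))
    (lt : tup M G -> tup M G -> Prop) (S : set (tup M G)) (a : tup M G) :
    Prop :=
  exists E, def_equivalence p E /\
    S = [set x | [/\ realizations p x, E a x & a = x \/ lt a x]].

Definition simple_pair (L : language) (M : structure L) (A : set (elt M))
    (G : seq (sorts L)) (p : set (pformula A G))
    (lt : tup M G -> tup M G -> Prop) : Prop :=
  forall S a, semiinterval p lt S a -> determined p lt S a.

Definition simple_type (L : language) (M : structure L) (A : set (elt M))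
    (G : seq (sorts L)) (p : set (pformula A G)) : Prop :=
  forall lt, wom_pair p lt -> simple_pair p lt.

(* Main.v *)
(** Let < be the order with simple semiintervals and <' another weakly o-minimal
    order on p(C). Automorphisms over A act transitively on p(C), so a property
    invariant under them holds everywhere or nowhere; hence every E in E_p has
    convex classes for both orders. Let R be a relatively A-definable binary
    relation. Cut the half-line above a into its maximal intervals on which R(a, .)
    is constant: the downward closures of these pieces are <-semiintervals with
    minimum a, so they are given by some E_1, ..., E_n in E_p, and for x < y the
    truth of R(x, y) depends only on the truth of the E_i(x, y). Apply this to <',
    to "y lies in S'(x)" and to its converse, where S'(x) are the conjugates of a
    <'-semiinterval S'(a). Then for x <' y, whether y is in S'(x) depends only on
    the truth of finitely many E_i(x, y), and the intersection of those E_i whose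
    class of a contains S'(a) determines S'(a). *)

Require Import Defs.
From mathcomp Require Import all_boot.
From Stdlib Require List.
From mathcomp Require Import boolp classical_sets functions cardinality.
Set Implicit Arguments.
Unset Strict Implicit.
Unset Printing Implicit Defensive.
Local Open Scope classical_set_scope.
Local Open Scope card_scope.

(** * Tuples, variables and renaming *)

Section Tuples.
Variables (S : Type).
Implicit Types (M N : S -> Type) (G D : seq S).

Lemma lookup_map M N (h : forall s, M s -> N s) G s (v : var G s) (a : tup M G) :
  lookup v (tup_map h a) = h s (lookup v a).
Proof. by elim: v a => //= s' s0 G' v IH a. Qed.

Lemma tup_map_comp M N O (h : forall s, M s -> N s) (k : forall s, N s -> O s)
    G (a : tup M G) :
  tup_map k (tup_map h a) = tup_map (fun s x => k s (h s x)) a.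
Proof. by elim: G a => //= s G IH a; rewrite IH. Qed.

Lemma tup_map_cat M N (h : forall s, M s -> N s) G D (a : tup M G) (b : tup M D) :
  tup_map h (tup_cat a b) = tup_cat (tup_map h a) (tup_map h b).
Proof. by elim: G a => //= s G IH a; rewrite IH. Qed.

Lemma eq_tup_map M N (h k : forall s, M s -> N s) G (a : tup M G) :
  (forall s x, h s x = k s x) -> tup_map h a = tup_map k a.
Proof. by move=> e; elim: G a => //= s G IH a; rewrite e IH. Qed.

Fixpoint idvars G : tup (var G) G :=
  match G with
  | [::] => tt
  | s :: G' => (VHead s G', tup_map (fun _ v => VTail s v) (idvars G'))
  end.

Definition subst_vars M D (a : tup M D) G (r : tup (var D) G) : tup M G :=
  tup_map (fun s v => lookup v a) r.

Lemma subst_idvars M G (a : tup M G) : subst_vars a (idvars G) = a.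
Proof.
elim: G a => [|s G IH] /= a; first by case: a.
by case: a => x a; rewrite /subst_vars /= tup_map_comp /= [X in (_, X)]IH.
Qed.

Fixpoint tup_split M G D : tup M (G ++ D) -> tup M G * tup M D :=
  match G return tup M (G ++ D) -> tup M G * tup M D with
  | [::] => fun a => (tt, a)
  | s :: G' => fun a => ((a.1, (tup_split a.2).1), (tup_split a.2).2)
  end.

Lemma tup_split_cat M G D (a : tup M G) (b : tup M D) :
  tup_split (tup_cat a b) = (a, b).
Proof. by elim: G a => [|s G IH] /= a; [case: a | rewrite IH; case: a]. Qed.

Lemma tup_split_map M N (h : forall s, M s -> N s) G D (a : tup M (G ++ D)) :
  tup_split (tup_map h a) =
  (tup_map h (tup_split a).1, tup_map h (tup_split a).2).
Proof. by elim: G a => //= s G IH a; rewrite IH. Qed.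

(** The two weakenings into a concatenated context, cut out of the identity renaming so that
    naturality of [tup_split] evaluates them. *)
Definition idl G D : tup (var (G ++ D)) G := (tup_split (idvars (G ++ D))).1.
Definition idr G D : tup (var (G ++ D)) D := (tup_split (idvars (G ++ D))).2.

Lemma subst_idl M G D (a : tup M G) (b : tup M D) :
  subst_vars (tup_cat a b) (idl G D) = a.
Proof.
have := tup_split_map (fun s v => lookup v (tup_cat a b)) (idvars (G ++ D)).
by rewrite -/(subst_vars _ _) subst_idvars tup_split_cat => -[e _]; exact: esym.
Qed.

Lemma subst_idr M G D (a : tup M G) (b : tup M D) :
  subst_vars (tup_cat a b) (idr G D) = b.
Proof.
have := tup_split_map (fun s v => lookup v (tup_cat a b)) (idvars (G ++ D)).
by rewrite -/(subst_vars _ _) subst_idvars tup_split_cat => -[_ e]; exact: esym.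
Qed.

Lemma lookup_subst M D (a : tup M D) G (r : tup (var D) G) s (v : var G s) :
  lookup (lookup v r) a = lookup v (subst_vars a r).
Proof. by rewrite lookup_map. Qed.

Definition lift_vars s G D (r : tup (var D) G) : tup (var (s :: D)) (s :: G) :=
  (VHead s D, tup_map (fun _ v => VTail s v) r).

Lemma subst_lift M s G D (r : tup (var D) G) (a : tup M D) (x : M s) :
  subst_vars ((x, a) : tup M (s :: D)) (lift_vars s r) = (x, subst_vars a r).
Proof. by rewrite /subst_vars /= tup_map_comp. Qed.

End Tuples.

Section Renaming.
Variable L : language.
Implicit Types (G D : seq (sorts L)).

Fixpoint rename_term G D (r : tup (var D) G) s (t : term G s) : term D s :=
  match t in term _ s return term D s with
  | Var _ v => Var (lookup v r)
  | App f ts => App (rename_terms r ts)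
  end
with rename_terms G D (r : tup (var D) G) E (ts : terms G E) : terms D E :=
  match ts in terms _ E return terms D E with
  | TNil => TNil D
  | TCons _ _ t ts' => TCons (rename_term r t) (rename_terms r ts')
  end.

Scheme term_terms_ind := Induction for term Sort Prop
with terms_term_ind := Induction for terms Sort Prop.
Combined Scheme term_mutind from term_terms_ind, terms_term_ind.

Lemma eval_rename (M : structure L) G D (r : tup (var D) G) (a : tup M D) :
  (forall s (t : term G s), eval a (rename_term r t) = eval (subst_vars a r) t)
  /\ (forall E (ts : terms G E),
        evals a (rename_terms r ts) = evals (subst_vars a r) ts).
Proof.
apply: (@term_mutind L G
  (fun s t => eval a (rename_term r t) = eval (subst_vars a r) t)
  (fun E ts => evals a (rename_terms r ts) = evals (subst_vars a r) ts)) => //=.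
- by move=> s v; rewrite lookup_subst.
- by move=> f ts ->.
- by move=> s E t -> ts ->.
Qed.

Fixpoint rename G (f : formula G) : forall D, tup (var D) G -> formula D :=
  match f in formula G return forall D, tup (var D) G -> formula D with
  | Bot _ => fun D r => Bot D
  | Eq _ _ t u => fun D r => Eq (rename_term r t) (rename_term r u)
  | Rel _ _ ts => fun D r => Rel (rename_terms r ts)
  | Imp _ f1 f2 => fun D r => Imp (rename f1 r) (rename f2 r)
  | All _ s f1 => fun D r => All (rename f1 (lift_vars s r))
  end.

Lemma sat_rename (M : structure L) G (f : formula G) D (r : tup (var D) G)
    (a : tup M D) :
  sat (rename f r) a <-> sat f (subst_vars a r).
Proof.
elim: f D r a => {G} /=.
- by [].
- by move=> G s t u D r a; rewrite !(eval_rename r a).1.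
- by move=> G R ts D r a; rewrite (eval_rename r a).2.
- by move=> G f1 IH1 f2 IH2 D r a; rewrite IH1 IH2.
- by move=> G s f1 IH D r a; split=> H x; have := H x; rewrite IH subst_lift.
Qed.

End Renaming.

(** * Definable sets and automorphisms *)

Section Definability.
Variables (L : language) (M : structure L).
Implicit Types (G D E : seq (sorts L)) (A B : set (elt M)).

Lemma tup_ext G (a b : tup M G) :
  (forall s (v : var G s), lookup v a = lookup v b) -> a = b.
Proof.
by move=> e; rewrite -(subst_idvars a) -(subst_idvars b); apply: eq_tup_map.
Qed.

Lemma entries_lookup G (a : tup M G) s (v : var G s) :
  entries a (existT _ s (lookup v a)).
Proof. by elim: v a => [s' G' | s' s0 G' v IH] a /=; [left | right]. Qed.

Lemma entries_var G (a : tup M G) u :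
  entries a u -> exists v : var G (projT1 u), lookup v a = projT2 u.
Proof.
elim: G a => //= s G IH a [->|/IH[v e]]; first by exists (VHead s G).
by exists (VTail s v).
Qed.

(* An L_B-formula is encoded as an L-formula whose variables are assigned to
   variables of [G] or to elements of [B], possibly with repetitions: in contrast
   to [pformula], substitution and Boolean combinations need no bookkeeping of a
   parameter tuple. *)
Definition pvar B G s : Type := (var G s + {x : M s | B (existT _ s x)})%type.

Definition pval B G (a : tup M G) s (n : pvar B G s) : M s :=
  match n with inl v => lookup v a | inr x => sval x end.

Definition definable B G (X : set (tup M G)) : Prop :=
  exists D (f : formula D) (r : tup (pvar B G) D),
    forall a, X a <-> sat f (tup_map (pval a) r).

Definition free_vars B G : tup (pvar B G) G :=
  tup_map (fun s v => inl v : pvar B G s) (idvars G).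

Lemma pval_free_vars B G (a : tup M G) : tup_map (pval a) (free_vars B G) = a.
Proof. by rewrite tup_map_comp; exact: subst_idvars. Qed.

Lemma param_vars B G E (c : tup M E) : entries c `<=` B ->
  exists r : tup (pvar B G) E, forall a, tup_map (pval a) r = c.
Proof.
elim: E c => [|s E IH] /= c cB; first by exists tt; case: c {cB}.
have [r rP] : exists r : tup (pvar B G) E, forall a, tup_map (pval a) r = c.2.
  by apply: IH => u uc; apply: cB; right.
have Bc : B (existT _ s c.1) by apply: cB; left.
by exists (inr (exist _ c.1 Bc), r) => a /=; rewrite rP; case: (c).
Qed.

Lemma definable_holds B G (f : pformula B G) : definable B (holds f).
Proof.
case: f => E f c cB; have [r rP] := param_vars G cB.
exists (G ++ E), f, (tup_cat (free_vars B G) r) => a.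
by rewrite tup_map_cat pval_free_vars rP.
Qed.

Lemma definable_sat B G (f : formula G) : definable B (@sat L M G f).
Proof. by exists G, f, (free_vars B G) => a; rewrite pval_free_vars. Qed.

(** The elements of [B] in the assignment [r] are collected, in order and with repetitions, into one
    tuple [c]; then [r] factors through a renaming [q]. *)
Lemma definable_pformula B G (X : set (tup M G)) : definable B X ->
  exists f : pformula B G, forall a, X a <-> holds f a.
Proof.
case=> D [f [r fP]].
have [E [c [cB [q qP]]]] : exists E (c : tup M E), entries c `<=` B /\
    exists q : tup (var (G ++ E)) D,
      forall a, subst_vars (tup_cat a c) q = tup_map (pval a) r.
  elim: D r {f fP} => [|s D IH] r; first by exists [::], tt; split; [exact: sub0set | exists r].
  have [E [c [cB [q qP]]]] := IH r.2.
  case rx: r.1 => [v|x].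
    exists E, c; split=> //; exists (lookup v (idl G E), q) => a.
    by congr pair; [rewrite lookup_subst subst_idl rx | exact: qP].
  exists (s :: E), (sval x, c); split.
    by move=> u [->|/cB //]; exact: (svalP x).
  have xd (a : tup M G) := subst_idr a ((sval x, c) : tup M (s :: E)).
  pose q' := subst_vars (tup_cat (idl G (s :: E)) (idr G (s :: E)).2) q.
  have q'P (a : tup M G) :
      subst_vars (tup_cat a ((sval x, c) : tup M (s :: E))) q' =
      subst_vars (tup_cat a c) q.
    rewrite /subst_vars tup_map_comp; apply: eq_tup_map => s' v.
    rewrite -(lookup_map (fun s v => lookup v _)) tup_map_cat.
    rewrite -/(subst_vars _ _) subst_idl; congr (lookup _ (tup_cat _ _)).
    exact: (congr1 (fun t : tup M (s :: E) => t.2) (xd a)).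
  exists (lookup (VHead s E) (idr G (s :: E)), q') => a.
  by congr pair; [rewrite lookup_subst xd rx | exact: etrans (q'P a) (qP a)].
exists (PFormula (rename f q) cB) => a.
by rewrite /holds sat_rename qP.
Qed.

Lemma definable_pre B G D (X : set (tup M D)) (r : tup (pvar B G) D) :
  definable B X -> definable B [set a | X (tup_map (pval a) r)].
Proof.
case=> E [f [q qP]].
pose k s (n : pvar B D s) : pvar B G s :=
  match n with inl v => lookup v r | inr x => inr x end.
exists E, f, (tup_map k q) => a; rewrite /= qP tup_map_comp.
rewrite (@eq_tup_map _ _ _ _ (fun s n => pval a (k s n))) // => s [v|x] //=.
by rewrite lookup_map.
Qed.

Lemma definable_imp B G (X Y : set (tup M G)) :
  definable B X -> definable B Y -> definable B [set a | X a -> Y a].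
Proof.
case=> [D [f [r fP]]] [E [g [q gP]]].
exists (D ++ E), (Imp (rename f (idl D E)) (rename g (idr D E))), (tup_cat r q).
by move=> a /=; rewrite !sat_rename tup_map_cat subst_idl subst_idr fP gP.
Qed.

Lemma definable_set0 B G : definable B (set0 : set (tup M G)).
Proof. exact: (definable_sat B (Bot G)). Qed.

Lemma definable_not B G (X : set (tup M G)) :
  definable B X -> definable B [set a | ~ X a].
Proof. by move=> dX; apply: definable_imp dX (definable_set0 B G). Qed.

Lemma definable_and B G (X Y : set (tup M G)) :
  definable B X -> definable B Y -> definable B [set a | X a /\ Y a].
Proof.
move=> dX dY.
rewrite (_ : [set _ | _] = [set a | ~ (X a -> ~ Y a)]).
  exact/definable_not/definable_imp/definable_not.
apply/seteqP; split=> a /=; first by case=> Xa Ya /(_ Xa).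
by move=> /not_implyP[Xa /contrapT].
Qed.

Lemma definable_or B G (X Y : set (tup M G)) :
  definable B X -> definable B Y -> definable B [set a | X a \/ Y a].
Proof.
move=> dX dY; rewrite (_ : [set _ | _] = [set a | ~ X a -> Y a]).
  exact/definable_imp/dY/definable_not.
apply/seteqP; split=> a /=; first by case.
by move=> H; have [|/H] := pselect (X a); [left | right].
Qed.

Lemma definable_sub B B' G (X : set (tup M G)) :
  B `<=` B' -> definable B X -> definable B' X.
Proof.
move=> BB' [D [f [r fP]]].
pose k s (n : pvar B G s) : pvar B' G s :=
  match n with inl v => inl v | inr x => inr (exist _ _ (BB' _ (svalP x))) end.
exists D, f, (tup_map k r) => a; rewrite fP tup_map_comp.
by rewrite (@eq_tup_map _ _ _ _ (fun s n => pval a (k s n))) // => s [].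
Qed.

(** * Invariance of definable sets under automorphisms *)

Definition fixes (g : forall s, M s -> M s) B : Prop :=
  forall s (x : M s), B (existT _ s x) -> g s x = x.

Lemma eval_aut (g : forall s, M s -> M s) G (a : tup M G) : automorphism g ->
  (forall s (t : term G s), eval (tup_map g a) t = g s (eval a t)) /\
  (forall D (ts : terms G D), evals (tup_map g a) ts = tup_map g (evals a ts)).
Proof.
move=> ag; apply: (@term_mutind L G
  (fun s t => eval (tup_map g a) t = g s (eval a t))
  (fun D ts => evals (tup_map g a) ts = tup_map g (evals a ts))) => //=.
- by move=> s v; rewrite lookup_map.
- by move=> f ts ->; rewrite (aut_fun ag).
- by move=> s D t -> ts ->.
Qed.

Lemma sat_aut (g : forall s, M s -> M s) G (f : formula G) (a : tup M G) :
  automorphism g -> sat f (tup_map g a) <-> sat f a.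
Proof.
move=> ag; elim: f a => {G} /=.
- by [].
- move=> G s t u a; rewrite !(eval_aut a ag).1; split=> [|-> //].
  by have [h gK _] := aut_bij ag s; exact: can_inj gK _ _.
- by move=> G R ts a; rewrite (eval_aut a ag).2 -(aut_rel ag).
- by move=> G f1 IH1 f2 IH2 a; rewrite IH1 IH2.
- move=> G s f1 IH a; split=> H x; first by rewrite -IH; exact: H.
  by have [h _ hK] := aut_bij ag s; rewrite -(hK x) (IH (h x, a)).
Qed.

Lemma definable_aut (g : forall s, M s -> M s) B G (X : set (tup M G)) a :
  automorphism g -> fixes g B -> definable B X -> X (tup_map g a) <-> X a.
Proof.
move=> ag gB [D [f [r fP]]]; rewrite !fP (@eq_tup_map _ _ _ _ (fun s n => g s (pval a n))); first last.
  by move=> s [v|x] /=; rewrite ?lookup_map // gB //; exact: (svalP x).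
by rewrite -tup_map_comp; exact: sat_aut.
Qed.

Lemma tup_map_surj (g : forall s, M s -> M s) G (a : tup M G) :
  automorphism g -> exists b, tup_map g b = a.
Proof.
move=> ag; elim: G a => [|s G IH] /= a; first by exists tt; case: a.
have [b bP] := IH a.2; have [h _ hK] := aut_bij ag s.
by exists (h a.1, b); rewrite /= hK bP; case: (a).
Qed.

End Definability.

(** * Small sets, homogeneity and compactness *)

Section Cardinality.

(** Hilbert's hotel: on an embedded copy of the natural numbers [g] shifts every element down by one
    and sends the first to [x], so it maps [A] onto the union. *)
Lemma card_setU1_infinite (U : Type) (A : set U) (x : U) :
  [set: nat] #<= A -> A `|` [set x] #<= A.
Proof.
elim/Ppointed: U => U in A x *; first by case: (no x).
move=> /pcard_leP[nu].
have nuA n : A (nu n) by exact: (@funS _ _ _ _ nu n I).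
have nuI : injective nu by move=> m n; apply: (@inj _ _ _ nu); rewrite ?inE.
pose g y := if pselect (exists n, y = nu n) is left e then
              (if sval (cid e) is n.+1 then nu n else x) else y.
have gnu n : g (nu n) = if n is m.+1 then nu m else x.
  rewrite /g; case: pselect => [e|[]]; last by exists n.
  by case: (cid e) => m /= /nuI <-.
apply/pcard_surjP; exists g => y [Ay|->]; last by exists (nu 0); rewrite ?gnu.
have [[n ->]|ny] := pselect (exists n, y = nu n).
  by exists (nu n.+1); rewrite ?gnu.
by exists y => //; rewrite /g; case: pselect.
Qed.

(** Some [k] lies outside the image of [A], else [K] would embed in [A]; it receives [x]. If [K]
    embedded in the union, [A] would be infinite, hence as large as the union. *)
Lemma card_ltT_setU1 (U K : Type) (A : set U) (x : U) :
  [set: nat] #<= [set: K] -> card_ltT K A -> card_ltT K (A `|` [set x]).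
Proof.
move=> Kinf [AK nKA]; split.
  elim/Ppointed: K => K in Kinf AK nKA *.
    by move/infiniteP/infinite_setN0: Kinf => -[k]; case: (no k).
  move/pcard_leP: AK => [f].
  have [k kP] : exists k, forall a, A a -> f a <> k.
    apply: contrapT => H; apply: nKA; elim/Ppointed: U => U in A x f H *.
      by case: (no x).
    apply/pcard_surjP; exists f => k _; apply: contrapT => nk; apply: H.
    by exists k => a Aa fa; apply: nk; exists a.
  apply/pcard_injP; exists (fun y => if pselect (A y) is left _ then f y else k).
  move=> y z; rewrite !inE /= => Hy Hz.
  case: pselect => [Ay|nAy]; case: pselect => [Az|nAz].
  - by apply: (@inj _ _ _ f); rewrite inE.
  - by move/(kP _ Ay).
  - by move/esym/(kP _ Az).
  - by case: Hy => // ->; case: Hz => // ->.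
move=> KA; apply: nKA; apply: (card_le_trans KA).
apply: card_setU1_infinite; apply/infiniteP => Afin.
have : finite_set [set: K].
  by apply: card_le_finite KA _; rewrite finite_setU; split.
exact/infiniteP.
Qed.

End Cardinality.

Lemma finite_set_list (U : Type) (F : set U) :
  finite_set F -> exists s : seq U, forall x, F x <-> List.In x s.
Proof.
move=> /(@finite_seqP {classic U})[s ->]; exists s => x /=.
elim: s => //= y s <-; rewrite inE; split.
  by case/orP => [/eqP ->|]; [left | right].
by case=> [->|xs]; apply/orP; [left; apply/eqP | right].
Qed.

(** Takes the value n at the n-fold negation of [Bot], which witnesses that there are infinitely
    many formulas. *)
Fixpoint formula_depth (L : language) (G : seq (sorts L)) (f : formula G) : nat :=
  if f is Imp _ f1 _ then (formula_depth f1).+1 else 0.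

Lemma monster_infinite (K : Type) (L : language) (T : theory L) (M : structure L) :
  monster K T M -> [set: nat] #<= [set: K].
Proof.
move=> /monster_large[FK _]; apply: card_le_trans FK; apply/pcard_surjP.
exists (fun f => formula_depth (projT2 f)) => n _.
by exists (existT _ [::] (iter n (@Neg L [::]) (Bot [::]))) => //; elim: n => //= n ->.
Qed.

Section Saturation.
Variables (K : Type) (L : language) (M : structure L).
Hypotheses (Kinf : [set: nat] #<= [set: K]) (Msat : saturated K M)
  (Mhom : strongly_homogeneous K M).
Implicit Types (G D E : seq (sorts L)) (A B : set (elt M)).

Lemma small_entries B E (c : tup M E) : small K B -> small K (B `|` entries c).
Proof.
move=> sB; elim: E c => [|s E IH] c /=; first by rewrite setU0.
by rewrite setUCA setUC; apply: card_ltT_setU1 => //; exact: IH.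
Qed.

(** Strong homogeneity is applied to the map that sends the entries of [a] to those of [b] and fixes
    all else; equality of types makes it elementary on [B] and [a]. *)
Lemma homogeneous_type B G (a b : tup M G) :
  small K B -> (forall X, definable B X -> X a -> X b) ->
  exists g, [/\ automorphism g, fixes g B & tup_map g a = b].
Proof.
move=> sB ab.
have ab_iff X : definable B X -> X a <-> X b.
  move=> dX; split; first exact: ab.
  by move=> Xb; apply: contrapT => nXa; exact: (ab _ (definable_not dX)).
pose h s (x : M s) := if pselect (exists v : var G s, lookup v a = x) is left e
  then lookup (sval (cid e)) b else x.
(* [cid] may choose another variable [w] with the same value in [a]; the formula equating [w] and
   [v] passes to [b]. *)
have ha s (v : var G s) : h s (lookup v a) = lookup v b.
  rewrite /h; case: pselect => [e|[]]; last by exists v.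
  case: (cid e) => w /= wv.
  by apply: (ab _ (definable_sat B (Eq (Var w) (Var v)))).
have hB s (x : M s) : B (existT _ s x) -> h s x = x.
  move=> Bx; rewrite /h; case: pselect => [e|//]; case: (cid e) => w /= wx.
  pose f := Eq (Var (VHead s [:: s])) (Var (VTail s (VHead s [::]))).
  pose r : tup (pvar B G) [:: s; s] := (inl w, (inr (exist _ x Bx), tt)).
  by apply: (ab _ (definable_pre r (definable_sat B f))).
have hel : elementary_on (B `|` entries a) h.
  move=> D f c cBa.
  have [r [<- <-]] : exists r : tup (pvar B G) D,
      tup_map (pval a) r = c /\ tup_map (pval b) r = tup_map h c.
    elim: D c cBa {f} => [|s D IH] c cBa; first by exists c.
    have [|r [ra rb]] := IH c.2; first by move=> u uc; apply: cBa; right.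
    have [n [na nb]] : exists n : pvar B G s,
        pval a n = c.1 /\ pval b n = h s c.1.
      have [Bc|/entries_var[v /= vc]] : (B `|` entries a) (existT _ s c.1).
      - by apply: cBa; left.
      - by exists (inr (exist _ c.1 Bc)); rewrite /= hB.
      - by exists (inl v); rewrite /= -vc ha.
    by exists (n, r) => /=; rewrite na nb ra rb; case: (c).
  exact: (ab_iff _ (definable_pre r (definable_sat B f))).
have [g [ag gh]] := Mhom (small_entries a sB) hel.
exists g; split=> //.
  by move=> s x Bx; rewrite gh ?hB //; left.
by apply: tup_ext => s v; rewrite lookup_map gh ?ha //; right; exact: entries_lookup.
Qed.

(** The members of [Q] need not be definable. Their supersets definable over [B] give a finitely
    satisfiable set of formulas, because by directedness finitely many of them contain a common
    member of [Q]. *)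
Lemma compactness B G (Q : set (set (tup M G))) :
  small K B -> Q !=set0 -> (forall X, Q X -> X !=set0) ->
  (forall X Y, Q X -> Q Y -> exists2 Z, Q Z & Z `<=` X `&` Y) ->
  exists y, forall X Y, Q X -> definable B Y -> X `<=` Y -> Y y.
Proof.
move=> sB [X0 QX0] Qne Qdir.
pose q : set (pformula B G) := [set f | exists2 X, Q X & X `<=` [set a | holds f a]].
have [|y qy] := @Msat B G q sB.
  move=> q0 /finite_set_list[s sP] q0q.
  have [X QX Xs] : exists2 X, Q X & forall f, List.In f s -> forall a, X a -> holds f a.
    have : forall f, List.In f s -> q f by move=> f /sP/q0q.
    elim: s {q0 sP q0q} => [|f s IH] sq; first by exists X0.
    have [|X QX Xs] := IH; first by move=> g gs; apply: sq; right.
    have [Y QY Yf] := sq f (or_introl erefl).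
    have [Z QZ ZXY] := Qdir _ _ QX QY; exists Z => // g [<-|gs] a /ZXY[Xa Ya].
      exact: Yf.
    exact: Xs.
  by have [a Xa] := Qne _ QX; exists a => f /sP fs; exact: Xs Xa.
exists y => X Y QX /definable_pformula[f fP] XY; apply/fP/qy; exists X => // a Xa.
exact/fP/XY.
Qed.

(* Types over [B] of elements of [X] and of elements outside [X] are distinct by
   homogeneity, so compactness first isolates each element of [X] by a formula
   over [B] that implies [X] on the realizations of [p], and then covers [X] by
   finitely many of these formulas; no quantifiers over parameters are needed. *)
Lemma invariant_definable A G (p : set (pformula A G)) B (X : set (tup M G)) :
  A `<=` B -> small K B -> rel_definable p X ->
  (forall g, automorphism g -> fixes g B ->
     forall x, realizations p x -> X x -> X (tup_map g x)) ->
  rel_definable_over p B X.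
Proof.
move=> AB sB [B0 [[E f c cB0]]]; rewrite /holds /= => XP Xinv.
pose P := realizations p; pose F := [set a : tup M G | sat f (tup_cat a c)].
pose B2 := B `|` entries c.
have sB2 : small K B2 by exact: small_entries.
have dF : definable B2 F.
  exact: (definable_holds (PFormula f (@subsetUr _ B (entries c)))).
have dp h : definable B2 [set a | @holds L M A G h a].
  by apply: (definable_sub _ (definable_holds h)) => u /AB; left.
have dB Y : definable B Y -> @definable L M B2 G Y.
  by apply: definable_sub => u; left.
have sep x : P x -> X x -> exists Th, [/\ definable B Th, Th x &
    forall y, P y -> Th y -> X y].
  move=> Px Xx; apply: contrapT => nsep.
  pose cut Th : set (tup M G) := [set y | [/\ P y, Th y & ~ X y]].
  have inT : exists Th, [/\ definable B Th, Th x & cut (~` set0) = cut Th].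
    by exists (~` set0); split=> //; exact/definable_not/definable_set0.
  have [|||y yP] := @compactness B2 G
      [set Z | exists Th, [/\ definable B Th, Th x & Z = cut Th]] sB2.
  - by exists (cut (~` set0)).
  - move=> _ [Th [dTh Thx ->]]; apply: contrapT => ne; apply: nsep.
    exists Th; split=> // y Py Thy; apply: contrapT => nXy; apply: ne.
    by exists y.
  - move=> _ _ [Th [dTh Thx ->]] [Th' [dTh' Th'x ->]].
    exists (cut [set a | Th a /\ Th' a]).
      by exists [set a | Th a /\ Th' a]; split=> //; exact: definable_and.
    by move=> y [Py [Ty T'y] nXy].
  have Py : P y by move=> h ph; apply: (yP _ _ inT (dp h)) => z [+ _ _]; apply.
  have nFy : ~ F y.
    by apply: (yP _ _ inT (definable_not dF)) => z [Pz _ nXz] Fz; apply/nXz/XP.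
  (* [y] has the type of [x] over [B], so some automorphism over [B] moves [x] to [y], and
     invariance puts [y] into [X], against [nFy]. *)
  have [Y dY Yx|g [ag gB gxy]] := @homogeneous_type B G x y sB.
    by apply: (yP (cut Y) _ _ (dB _ dY)); [exists Y | move=> z []].
  by apply/nFy/XP => //; rewrite -gxy; exact: Xinv.
suff [Th [dTh ThX XTh]] : exists Th, [/\ definable B Th,
    forall y, P y -> Th y -> X y & forall y, P y -> X y -> Th y].
  have [h hP] := definable_pformula dTh; exists h => a Pa.
  by rewrite -hP; split; [exact: XTh | exact: ThX].
apply: contrapT => nTh.
(* The points of [X] not yet covered by [Th]; unions of sets [Th] that imply [X] make this family
   directed. *)
pose cut Th : set (tup M G) := [set y | [/\ P y, X y & ~ Th y]].
have in0 : exists Th, [/\ definable B Th, forall y, P y -> Th y -> X y &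
    cut set0 = cut Th] by exists set0; split=> //; exact: definable_set0.
have [|||y yP] := @compactness B2 G
    [set Z | exists Th, [/\ definable B Th, forall y, P y -> Th y -> X y &
       Z = cut Th]] sB2.
- by exists (cut set0).
- move=> _ [Th [dTh ThX ->]]; apply: contrapT => ne; apply: nTh.
  exists Th; split=> // y Py Xy; apply: contrapT => nThy; apply: ne.
  by exists y.
- move=> _ _ [Th [dTh ThX ->]] [Th' [dTh' Th'X ->]].
  exists (cut [set a | Th a \/ Th' a]).
    exists [set a | Th a \/ Th' a]; split=> //; first exact: definable_or.
    by move=> y Py [/ThX|/Th'X]; apply.
  by move=> y [Py Xy /not_orP[]].
have Py : P y by move=> h ph; apply: (yP _ _ in0 (dp h)) => z [+ _ _]; apply.
have Xy : X y by apply/XP => //; apply: (yP _ _ in0 dF) => z [Pz Xz _]; exact/XP.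
have [Th [dTh Thy ThX]] := sep y Py Xy.
by apply: (yP (cut Th) _ _ (definable_not (dB _ dTh))) Thy; [exists Th | move=> z []].
Qed.

End Saturation.

Lemma finite_list_set (U : Type) (s : seq U) : finite_set [set x | List.In x s].
Proof.
elim: s => [|x s IH]; first by rewrite (_ : [set _ | _] = set0).
rewrite (_ : [set _ | _] = x |` [set y | List.In y s]).
  by rewrite finite_setU; split; first exact: finite_set1.
by apply/seteqP; split=> y [->|]; by [left | right].
Qed.

Lemma pigeonhole_list (U : Type) (s : seq U) (c : nat -> U) :
  (forall n, List.In (c n) s) -> exists i j, (i < j)%N /\ c i = c j.
Proof.
move=> cs; apply: contrapT => nc.
have cI : injective c.
  move=> i j cij; apply: contrapT => /eqP; rewrite neq_ltn => /orP[ij|ji].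
    by apply: nc; exists i, j.
  by apply: nc; exists j, i.
apply: infinite_nat.
have : finite_set (c @` [set: nat]).
  by apply: sub_finite_set (finite_list_set s) => _ [n _ <-]; exact: cs.
by rewrite (eq_finite_set (inj_card_eq _)) // => i j _ _ /cI.
Qed.

(** * Convex sets in linear orders *)

Section LinearOrders.
Variables (U : Type) (D : set U) (lt : U -> U -> Prop).
Hypothesis lt_lin : linear_order_on D lt.

Definition le_of (x y : U) : Prop := x = y \/ lt x y.
Local Notation le := le_of.

Lemma lin_irr x : D x -> ~ lt x x.
Proof. by case: lt_lin => + _ _; apply. Qed.

Lemma lin_trans x y z : D x -> D y -> D z -> lt x y -> lt y z -> lt x z.
Proof. by case: lt_lin => _ + _; apply. Qed.

Lemma lin_total x y : D x -> D y -> [\/ lt x y, x = y | lt y x].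
Proof. by case: lt_lin => _ _; apply. Qed.

Lemma lin_asym x y : D x -> D y -> lt x y -> ~ lt y x.
Proof. by move=> Dx Dy xy /(lin_trans Dx Dy Dx xy); exact: lin_irr. Qed.

Lemma lin_ltNge x y : D x -> D y -> lt x y <-> ~ le y x.
Proof.
move=> Dx Dy; split=> [xy [yx|yx]|].
- by move: xy; rewrite yx; exact: lin_irr.
- exact: (lin_asym Dx Dy).
- by case: (lin_total Dx Dy) => // [->|yx] []; [left | right].
Qed.

Lemma lin_le_lt_trans x y z : D x -> D y -> D z -> le x y -> lt y z -> lt x z.
Proof. by move=> Dx Dy Dz [-> //|]; exact: lin_trans. Qed.

Lemma lin_lt_le_trans x y z : D x -> D y -> D z -> lt x y -> le y z -> lt x z.
Proof. by move=> Dx Dy Dz xy [<- //|]; exact: lin_trans. Qed.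

Lemma lin_le_trans x y z : D x -> D y -> D z -> le x y -> le y z -> le x z.
Proof.
move=> Dx Dy Dz xy [<- //|yz].
by right; exact: lin_le_lt_trans yz.
Qed.

(* [w] is taken in a member of the cover such that no element of [W] lies to the
   left of all the elements of [W] in that member. *)
Lemma convex_cover (s : seq (set U)) (W : set U) :
  (forall Y, List.In Y s -> convex_in D lt Y) -> W `<=` D -> W !=set0 ->
  (forall x, W x -> exists2 Y, List.In Y s & Y x) ->
  exists2 w, W w & forall u v, W u -> D v -> lt u v -> lt v w ->
    exists2 Y, List.In Y s & Y v.
Proof.
elim: s W => [|Y s IH] W sC WD W0 Ws.
  by case: W0 => x /Ws[Y].
have sC' Z : List.In Z s -> convex_in D lt Z by move=> sZ; apply: sC; right.
have [[x Wx Yx]|WY] := pselect (exists2 x, W x & Y x); last first.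
  have [|w Ww wP] := IH W sC' WD W0.
    move=> x Wx; have [Z [YZ|sZ] Zx] := Ws x Wx; last by exists Z.
    by case: WY; exists x; rewrite ?YZ.
  by exists w => // u v Wu Dv uv vw; have [Z sZ Zv] := wP u v Wu Dv uv vw; exists Z => //; right.
(* The induction continues with the points to the left of all of [W] in [Y]; none of them lies in
   [Y]. *)
pose W' := [set u | W u /\ forall v, Y v -> W v -> lt u v].
have [W'0|W'0] := pselect (W' !=set0).
  have [||w [Ww wY] wP] := IH W' sC' _ W'0; first by move=> u [/WD].
    move=> u [Wu uY]; have [Z [YZ|sZ] Zu] := Ws u Wu; last by exists Z.
    by case: (lin_irr (WD _ Wu)); apply: uY; rewrite ?YZ.
  exists w => // u v Wu Dv uv vw.
  have [|Z sZ Zv] := wP u v _ Dv uv vw; last by exists Z => //; right.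
  split=> // z Yz Wz; apply: (lin_trans (WD _ Wu) (WD _ Ww) (WD _ Wz)); last exact: wY.
  exact: (lin_trans (WD _ Wu) Dv (WD _ Ww)).
exists x => // u v Wu Dv uv vx; exists Y; first by left.
(* Since [W'] is empty, [Y] has a point at or below [u]; convexity of [Y] then captures [v], between
   that point and [x]. *)
have [v' Yv' [Wv' v'u]] : exists2 v', Y v' & W v' /\ le v' u.
  apply: contrapT => H; apply: W'0; exists u; split=> // v' Yv' Wv'.
  apply/lin_ltNge; [exact: WD | exact: WD |] => v'u.
  by apply: H; exists v'.
apply: ((sC Y (or_introl erefl)).2 v' x) => //.
exact: (lin_le_lt_trans (WD _ Wv') (WD _ Wu) Dv).
Qed.

End LinearOrders.

(** * Weakly o-minimal types *)

Section WeaklyOMinimalTypes.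
Variables (K : Type) (L : language) (M : structure L).
Hypotheses (Kinf : [set: nat] #<= [set: K]) (Msat : saturated K M)
  (Mhom : strongly_homogeneous K M).
Variables (A : set (elt M)) (G : seq (sorts L)) (p : set (pformula A G)).
Hypotheses (sA : small K A) (pcomplete : complete_type p).
Implicit Types (a b x y z : tup M G) (R E : tup M G -> tup M G -> Prop).
Local Notation P := (realizations p).

Lemma realizations_conj a b : P a -> P b ->
  exists g, [/\ automorphism g, fixes g A & tup_map g a = b].
Proof.
move=> Pa Pb; apply: (homogeneous_type Kinf Mhom) => // X.
move=> /definable_pformula[f fP] /fP fa; apply/fP.
have [/Pb//|/Pa nfa] := pcomplete.2 f.
by case: (nfa fa).
Qed.

Lemma realizations_aut (g : forall s, M s -> M s) a :
  automorphism g -> fixes g A -> P (tup_map g a) <-> P a.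
Proof.
move=> ag gA; split=> Pa f pf; move: (Pa f pf);
  by have := definable_aut a ag gA (definable_holds f) => /= ->.
Qed.

Lemma rel_definable2P B R : rel_definable_over2 p B R <->
  exists2 X, definable B X &
    forall a b, P a -> P b -> R a b <-> X (tup_cat a b).
Proof.
split=> [[f fP]|[X /definable_pformula[f fP] XP]].
  by exists (holds f) => //; exact: definable_holds.
by exists f => a b Pa Pb; rewrite XP // fP.
Qed.

Lemma rel_definable2_aut (g : forall s, M s -> M s) R a b :
  automorphism g -> fixes g A -> rel_definable_over2 p A R -> P a -> P b ->
  R (tup_map g a) (tup_map g b) <-> R a b.
Proof.
move=> ag gA /rel_definable2P[X dX XP] Pa Pb.
rewrite !XP ?realizations_aut // -tup_map_cat.
exact: (definable_aut _ ag gA dX).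
Qed.

Lemma rel_definable2_swap R :
  rel_definable_over2 p A R -> rel_definable_over2 p A (fun a b => R b a).
Proof.
move=> /rel_definable2P[X dX XP]; apply/rel_definable2P.
pose inv (s : sorts L) (v : var (G ++ G) s) : pvar A (G ++ G) s := inl v.
pose r := tup_cat (tup_map inv (idr G G)) (tup_map inv (idl G G)).
exists [set c | X (tup_map (pval c) r)]; first exact: definable_pre.
move=> a b Pa Pb; rewrite XP //= tup_map_cat !tup_map_comp /=.
by rewrite -!/(subst_vars _ _) subst_idl subst_idr.
Qed.

Lemma rel_definable2_at R a : rel_definable_over2 p A R -> P a ->
  rel_definable_over p (A `|` entries a) (R a).
Proof.
move=> /rel_definable2P[X dX XP] Pa.
have dX' : definable (A `|` entries a) X by apply: definable_sub dX => u; left.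
have [r rP] := param_vars G (@subsetUr _ A (entries a)).
have [f fP] := definable_pformula
  (definable_pre (tup_cat r (free_vars (A `|` entries a) G)) dX').
exists f => b Pb; rewrite -fP XP //= tup_map_cat pval_free_vars.
by rewrite rP.
Qed.

(** The parameters outside [A] are entries of [a] and become variables of the first block; thus [R]
    also describes the conjugates of [X]. *)
Lemma rel_definable_over_at a (X : set (tup M G)) :
  rel_definable_over p (A `|` entries a) X ->
  exists2 R, rel_definable_over2 p A R & forall b, P b -> X b <-> R a b.
Proof.
move=> [h hP]; have [D [f [r fP]]] := definable_holds h.
have [q qP] : exists q : tup (pvar A (G ++ G)) D,
    forall b, tup_map (pval (tup_cat a b)) q = tup_map (pval b) r.
  elim: D r {f fP} => [|s D IH] r; first by exists r.
  have [q qP] := IH r.2.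
  have [n nP] : exists n : pvar A (G ++ G) s,
      forall b, pval (tup_cat a b) n = pval b r.1.
    case: r.1 => [v|[x [Ax|/entries_var[v /= vx]]]].
    - by exists (inl (lookup v (idr G G))) => b /=; rewrite lookup_subst subst_idr.
    - by exists (inr (exist _ x Ax)).
    - by exists (inl (lookup v (idl G G))) => b /=; rewrite lookup_subst subst_idl.
  by exists (n, q) => b; congr pair; [exact: nP | exact: qP].
have [k kP] := definable_pformula (definable_pre q (definable_sat A f)).
exists (fun b c => holds k (tup_cat b c)); first by exists k.
by move=> b Pb; rewrite hP // fP -kP /= qP.
Qed.

Lemma rel_definableP (X : set (tup M G)) : rel_definable p X <->
  exists2 Y, definable setT Y & forall a, P a -> X a <-> Y a.
Proof.
split=> [[B [f fP]]|[Y /definable_pformula[f fP] YP]].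
  exists (holds f) => //.
  by apply: definable_sub (definable_holds f) => u _.
by exists setT, f => a Pa; rewrite YP.
Qed.

Lemma rel_definable_and (X Y : set (tup M G)) :
  rel_definable p X -> rel_definable p Y -> rel_definable p (X `&` Y).
Proof.
move=> /rel_definableP[X' dX' XP] /rel_definableP[Y' dY' YP].
apply/rel_definableP; exists [set a | X' a /\ Y' a]; first exact: definable_and.
by move=> a Pa; rewrite /setI /= XP // YP.
Qed.

Lemma rel_definable_compl (X : set (tup M G)) :
  rel_definable p X -> rel_definable p (~` X).
Proof.
move=> /rel_definableP[Y dY YP]; apply/rel_definableP.
exists [set a | ~ Y a]; first exact: definable_not.
by move=> a Pa; rewrite /setC /= YP.
Qed.

Lemma rel_definable_or (X Y : set (tup M G)) :
  rel_definable p X -> rel_definable p Y -> rel_definable p (X `|` Y).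
Proof.
move=> dX dY; rewrite -(setCK (X `|` Y)) setCU.
by apply/rel_definable_compl/rel_definable_and; exact: rel_definable_compl.
Qed.

Lemma rel_definable_ext (X Y : set (tup M G)) :
  (forall a, P a -> X a <-> Y a) -> rel_definable p X -> rel_definable p Y.
Proof. by move=> XY [B [f fP]]; exists B, f => a Pa; rewrite -XY ?fP. Qed.

Lemma rel_definable2_and R E : rel_definable_over2 p A R ->
  rel_definable_over2 p A E -> rel_definable_over2 p A (fun a b => R a b /\ E a b).
Proof.
move=> /rel_definable2P[X dX XP] /rel_definable2P[Y dY YP].
apply/rel_definable2P; exists [set c | X c /\ Y c]; first exact: definable_and.
by move=> a b Pa Pb; rewrite XP // YP.
Qed.

Lemma def_equivalence_true : def_equivalence p (fun _ _ => True).
Proof.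
split=> //; apply/rel_definable2P; exists (~` set0).
  exact/definable_not/definable_set0.
by move=> a b _ _; split=> // _ [].
Qed.

Lemma def_equivalence_and E F : def_equivalence p E -> def_equivalence p F ->
  def_equivalence p (fun a b => E a b /\ F a b).
Proof.
move=> [[Er Es Et] dE] [[Fr Fs Ft] dF]; split; last exact: rel_definable2_and.
split=> [x Px|x y Px Py [Exy Fxy]|x y z Px Py Pz [Exy Fxy] [Eyz Fyz]].
- by split; [exact: Er | exact: Fr].
- by split; [exact: Es | exact: Fs].
- by split; [exact: Et Exy Eyz | exact: Ft Fxy Fyz].
Qed.

(** [Q] need not be definable and may mention a point: it only selects a finite subfamily to be
    intersected. *)
Lemma def_equivalence_all (s : seq (tup M G -> tup M G -> Prop))
    (Q : (tup M G -> tup M G -> Prop) -> Prop) :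
  (forall E, List.In E s -> def_equivalence p E) ->
  def_equivalence p (fun a b => forall E, List.In E s -> Q E -> E a b).
Proof.
elim: s => [|F s IH] sE.
  rewrite (_ : (fun _ _ => _) = fun _ _ => True); first exact: def_equivalence_true.
  by apply/funext => a; apply/funext => b; apply/propext; split=> // _ E [].
have dF := sE F (or_introl erefl).
have ds : def_equivalence p (fun a b => forall E, List.In E s -> Q E -> E a b).
  by apply: IH => E Es; apply: sE; right.
have [QF|nQF] := pselect (Q F).
  have := def_equivalence_and dF ds; congr def_equivalence.
  apply/funext => a; apply/funext => b; apply/propext; split.
    by move=> [Fab sab] E [<-|Es] //; exact: sab.
  move=> H; split; first by apply: H; [left|].
  by move=> E Es; apply: H; right.
move: ds; congr def_equivalence.
apply/funext => a; apply/funext => b; apply/propext; split=> H E.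
  by case=> [<-|] //; exact: H.
by move=> Es; apply: H; right.
Qed.

(** * A single weakly o-minimal order *)

Section OnePair.
Variable lt : tup M G -> tup M G -> Prop.
Hypothesis lt_wom : wom_pair p lt.
Local Notation le := (le_of lt).
Let lt_lin := wom_order lt_wom.
Let lt_def := wom_definable lt_wom.

Lemma def_equivalence_eq : def_equivalence p eq.
Proof.
split; first by split=> // x y z _ _ _ ->.
have [X dX XP] := (rel_definable2P _ _).1 lt_def.
have [Y dY YP] := (rel_definable2P _ _).1 (rel_definable2_swap lt_def).
apply/rel_definable2P; exists [set c | ~ X c /\ ~ Y c].
  by apply: definable_and; exact: definable_not.
move=> a b Pa Pb /=; rewrite -XP // -YP //; split=> [<-|[nab nba]].
  by split; exact: (lin_irr lt_lin).
by case: (lin_total lt_lin Pa Pb).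
Qed.

Lemma wom_cover (X : set (tup M G)) : rel_definable p X ->
  exists s : seq (set (tup M G)),
    (forall Y, List.In Y s -> convex_in P lt Y) /\
    (forall x, P x -> X x <-> exists2 Y, List.In Y s & Y x).
Proof.
move=> dX; have [|F [/finite_set_list[s sP] cF XF]] :=
    @wom_convex _ _ _ _ _ _ lt_wom (X `&` P) (@subIsetr _ _ _).
  by apply: rel_definable_ext dX => a Pa; split=> // -[].
exists s; split=> [Y /sP/cF //|x Px].
have -> : X x <-> (X `&` P) x by split=> // -[].
by rewrite XF; split=> -[Y /sP FY Yx]; exists Y.
Qed.

Lemma lt_aut (g : forall s, M s -> M s) a b :
  automorphism g -> fixes g A -> P a -> P b ->
  lt (tup_map g a) (tup_map g b) <-> lt a b.
Proof. by move=> ag gA; exact: rel_definable2_aut. Qed.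

Lemma le_aut (g : forall s, M s -> M s) a b :
  automorphism g -> fixes g A -> P a -> P b ->
  le (tup_map g a) (tup_map g b) <-> le a b.
Proof.
move=> ag gA Pa Pb; split; last by move=> [->|/lt_aut ab]; [left | right; apply: ab].
have Pga : P (tup_map g a) by rewrite realizations_aut.
have Pgb : P (tup_map g b) by rewrite realizations_aut.
move=> ab; have [ab'| ->|ba] := lin_total lt_lin Pa Pb; [by right | by left |].
by have := (lin_ltNge lt_lin Pgb Pga).1 ((lt_aut ag gA Pb Pa).2 ba).
Qed.

(* If a class were not convex, then by transitivity every element of it would
   have a smaller element of the class beyond a gap, hence there would be
   infinitely many gaps. *)
Lemma def_equivalence_convex E a b c : def_equivalence p E ->
  P a -> P b -> P c -> E a c -> lt a b -> lt b c -> E a b.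
Proof.
move=> [[Er Es Et] dE] Pa Pb Pc Eac ab bc; apply: contrapT => nEab.
(* A gap below [u]: [y] is in the class of [u], and [z] between them is not. *)
pose broken u := exists y z, [/\ P y, P z, E y u, ~ E z u & lt y z /\ lt z u].
have bc0 : broken c.
  exists a, b; split=> // Ebc; apply: nEab.
  by apply: Et Eac _ => //; exact: Es.
(* Being broken is invariant over [A], so it passes from [c] to every realization. *)
have all_broken u : P u -> broken u.
  move=> Pu; have [g [ag gA <-]] := realizations_conj Pc Pu.
  have [y [z [Py Pz Eyc nEzc [yz zc]]]] := bc0.
  exists (tup_map g y), (tup_map g z).
  by split; rewrite ?realizations_aut // ?(rel_definable2_aut ag gA dE) // !lt_aut.
pose W := [set x | P x /\ E c x].
have [|s [sC sW]] := @wom_cover (E c).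
  by exists (A `|` entries c); exact: rel_definable2_at.
have [|||w [Pw Ecw] wP] := @convex_cover _ P lt lt_lin s W sC.
- by move=> x [].
- by exists c; split=> //; exact: Er.
- by move=> x [Px /sW]; apply.
have [y [z [Py Pz Eyw nEzw [yz zw]]]] := all_broken w Pw.
apply: nEzw; apply: (Et _ c) => //; apply: (Es) => //; apply/sW => //.
apply: (wP y) => //; split=> //.
by apply: (Et c w y) => //; exact: Es.
Qed.

(** * Maximal intervals on which a definable set is constant *)

Section Pieces.
Variables (a : tup M G) (X : set (tup M G)).
Hypotheses (Pa : P a) (dX : rel_definable_over p (A `|` entries a) X).

(* The downward closure in the half-line from [a] of the maximal interval around
   [y] on which [X] is constant. *)
Definition piece y : set (tup M G) :=
  [set z | [/\ P z, le a z &
    forall w, P w -> le y w -> le w z -> (X w <-> X y)]].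

Lemma homogeneous_cover : exists s : seq (set (tup M G)),
  [/\ forall Y, List.In Y s -> convex_in P lt Y,
      forall x, P x -> exists2 Y, List.In Y s & Y x &
      forall Y x y, List.In Y s -> Y x -> Y y -> (X x <-> X y)].
Proof.
have dX' : rel_definable p X by exists (A `|` entries a).
have [s1 [c1 X1]] := wom_cover dX'.
have [s2 [c2 X2]] := wom_cover (rel_definable_compl dX').
exists (s1 ++ s2); split.
- by move=> Y /List.in_app_iff[/c1|/c2].
- move=> x Px; have [/X1|/X2] := pselect (X x).
    by case=> // Y sY Yx; exists Y => //; apply/List.in_app_iff; left.
  by case=> // Y sY Yx; exists Y => //; apply/List.in_app_iff; right.
- move=> Y x y /List.in_app_iff[sY|sY] Yx Yy.
    have [YP _] := c1 Y sY.
    have Xx : X x by apply/X1; [exact: YP | exists Y].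
    by have Xy : X y by apply/X1; [exact: YP | exists Y].
  have [YP _] := c2 Y sY.
  have nXx : (~` X) x by apply/X2; [exact: YP | exists Y].
  by have nXy : (~` X) y by apply/X2; [exact: YP | exists Y].
Qed.

(** The points between [u] and [v] lie in [Y], where [X] is constant. Hence there are at most as
    many pieces as members of the cover. *)
Lemma piece_eq (Y : set (tup M G)) u v : convex_in P lt Y ->
  (forall x y, Y x -> Y y -> (X x <-> X y)) -> Y u -> Y v -> piece u = piece v.
Proof.
move=> [YP Yc] YX.
suff sub x y : Y x -> Y y -> piece x `<=` piece y.
  by move=> Yu Yv; apply/seteqP; split; exact: sub.
move=> Yx Yy z [Pz az xz]; split=> // w Pw yw wz.
have [xw|nxw] := pselect (le x w); first by rewrite xz //; exact: YX.
have wx : lt w x by apply/(lin_ltNge lt_lin) => //; exact: YP.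
apply: YX => //; case: yw => [<- //|yw].
exact: Yc yw wx.
Qed.

Section Automorphism.
Variable g : forall s, M s -> M s.
Hypotheses (ag : automorphism g) (gB : fixes g (A `|` entries a)).

Let gA : fixes g A.
Proof. by move=> s x Ax; apply: gB; left. Qed.

Let ga : tup_map g a = a.
Proof.
apply: tup_ext => s v; rewrite lookup_map; apply: gB; right; exact: entries_lookup.
Qed.

Let X_aut x : P x -> X (tup_map g x) <-> X x.
Proof.
case: dX => f fP Px; rewrite !fP ?realizations_aut //.
exact: (definable_aut _ ag gB (definable_holds f)).
Qed.

Lemma piece_aut y z : P y -> P z -> piece (tup_map g y) (tup_map g z) <-> piece y z.
Proof.
move=> Py Pz; split=> -[_ az yz]; split=> //.
- by move: az; rewrite -{1}ga le_aut.
- move=> w Pw yw wz; rewrite -(X_aut Pw) -(X_aut Py).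
  by apply: yz; [apply/realizations_aut | apply/le_aut | apply/le_aut].
- by rewrite realizations_aut.
- by rewrite -{1}ga le_aut.
- move=> w'; have [w <-] := tup_map_surj w' ag.
  by rewrite realizations_aut // => Pw; rewrite !le_aut // !X_aut //; exact: yz.
Qed.

(** Both pieces are initial segments of the half-line from [a], hence comparable by inclusion; the
    point [w] decides which is the larger. *)
Lemma piece_initial y y' z w : P y -> P y' -> piece y z -> piece y' w -> ~ piece y w ->
  piece y' z.
Proof.
move=> Py Py' [Pz az yz] [Pw aw y'w] nyw; split=> // v Pv y'v vz.
have zw : lt z w.
  apply/(lin_ltNge lt_lin) => // wz; apply: nyw; split=> // u Pu yu uw.
  by apply: yz => //; exact: (lin_le_trans lt_lin) uw wz.
apply: y'w => //; right; exact: (lin_le_lt_trans lt_lin) vz zw.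
Qed.

(* Otherwise the pieces of the iterates of [y] form a strictly increasing
   sequence, while the cover allows only finitely many pieces. *)
Lemma piece_invariant y z : P y -> piece y z -> piece y (tup_map g z).
Proof.
move=> Py yz; apply: contrapT => nyz.
have Pz : P z by case: yz.
pose y_ n := iter n (@tup_map _ _ _ g G) y.
pose z_ n := iter n (@tup_map _ _ _ g G) z.
have Py_ n : P (y_ n) by elim: n => //= n IH; rewrite realizations_aut.
have Pz_ n : P (z_ n) by elim: n => //= n IH; rewrite realizations_aut.
have yz_ n : piece (y_ n) (z_ n) by elim: n => //= n IH; apply/piece_aut.
have nyz_ n : ~ piece (y_ n) (z_ n.+1).
  by elim: n => // n; apply: contra_not; exact: (piece_aut (Py_ n) (Pz_ n.+1)).1.
(* [z_ n.+1] is in the piece of [y_ n.+1] but not in that of [y_ n], so the pieces increase. *)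
have mono i k : piece (y_ i) `<=` piece (y_ (k + i)).
  elim: k => //= k IH u /IH yu.
  exact: (piece_initial (Py_ (k + i)) (Py_ (k + i).+1) yu (yz_ _) (nyz_ _)).
have [s [sC sP sX]] := homogeneous_cover.
have [n|c cP] := @choice nat _ (fun n Y => List.In Y s /\ Y (y_ n)).
  by have [Y] := sP _ (Py_ n); exists Y.
have [i [j [ij cij]]] := @pigeonhole_list _ s c (fun n => (cP n).1).
have yij : piece (y_ i) = piece (y_ j).
  apply: (@piece_eq (c i)).
  - exact/sC/(cP i).1.
  - by move=> u v; apply: sX; exact: (cP i).1.
  - exact: (cP i).2.
  - by rewrite cij; exact: (cP j).2.
(* [z_ i.+1] lies in the piece of [y_ i.+1], which is contained in that of [y_ j] because [i < j],
   and the latter is the piece of [y_ i]. *)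
apply: (nyz_ i); rewrite yij -(subnK ij); apply: mono; exact: yz_.
Qed.

End Automorphism.

(** By invariance over [A] and [a], a definition with arbitrary parameters suffices. *)
Lemma piece_definable y : P y -> rel_definable_over p (A `|` entries a) (piece y).
Proof.
move=> Py.
apply: (invariant_definable Kinf Msat Mhom _ (small_entries Kinf a sA)); first last.
- by move=> g ag gB x Px; exact: piece_invariant.
- have below b : P b -> rel_definable p (fun z => lt z b).
    move=> Pb; exists (A `|` entries b).
    exact: (rel_definable2_at (rel_definable2_swap lt_def) Pb).
  have above b : P b -> rel_definable p (lt b).
    by move=> Pb; exists (A `|` entries b); exact: rel_definable2_at.
  have dX' : rel_definable p X by exists (A `|` entries a).
  have dXy : rel_definable p (fun z => X z <-> X y).
    have [Xy|nXy] := pselect (X y).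
      by apply: rel_definable_ext dX' => z _; split=> [|[_]] //; apply.
    apply: rel_definable_ext (rel_definable_compl dX') => z _.
    by rewrite /setC /=; split=> [nXz|[XzXy _] /XzXy].
  (* The points above [y] where [X] has changed; if there are none, the piece is the whole half-line
     from [a]. *)
  pose W := [set w | [/\ P w, lt y w & ~ (X w <-> X y)]].
  have [W0|W0] := pselect (W !=set0); last first.
    apply: rel_definable_ext (rel_definable_compl (below a Pa)) => z Pz.
    split=> [nza|[_ az _] za]; last by case: ((lin_ltNge lt_lin Pz Pa).1 za).
    split=> //.
      by apply: contrapT => naz; apply/nza/(lin_ltNge lt_lin).
    move=> w Pw [<- //|yw] _; apply: contrapT => Xw; apply: W0.
    by exists w.
  have [s [sC sP]] := wom_cover (rel_definable_compl dXy).
  have [|||w [Pw yw Xwy] wP] := @convex_cover _ P lt lt_lin s W sC.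
  + by move=> x [].
  + exact: W0.
  + by move=> x [Px _ nXx]; apply/sP.
  (* Between any point of [W] and [w], [X] keeps the changed value. Below [w] it is therefore enough
     to test [X] at [z] itself. *)
  have piece_w z : P z ->
      (~ lt z a /\ (~ lt y z \/ lt z w /\ (X z <-> X y))) <-> piece y z.
    move=> Pz; split=> [[nza yzw]|[_ az yz]].
      split=> //; first by apply: contrapT => naz; apply/nza/(lin_ltNge lt_lin).
      move=> v Pv [<- //|yv] vz.
      case: yzw => [[]|[zw Xz]]; first exact: (lin_lt_le_trans lt_lin) yv vz.
      case: vz => [-> //|vz]; apply: contrapT => nXv.
      suff : (~` (fun z => X z <-> X y)) z by case.
      by apply/sP => //; apply: (wP v).
    split; first by move=> /(lin_ltNge lt_lin Pz Pa); apply.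
    have [yz'|] := pselect (lt y z); [right | by left].
    split; last by apply: yz => //; [right | left].
    by apply/(lin_ltNge lt_lin) => // wz; apply/Xwy/yz => //; right.
  apply: rel_definable_ext piece_w _; apply: rel_definable_and.
    exact/rel_definable_compl/below.
  apply: rel_definable_or; first exact/rel_definable_compl/above.
  by apply: rel_definable_and => //; exact: below.
- by move=> u; left.
Qed.

Lemma piece_semiinterval y : P y -> lt a y -> semiinterval p lt (piece y) a.
Proof.
move=> Py ay; split; last exact: piece_definable.
- split=> [z []|] // u v z [Pu au yu] [Pv av yv] Pz uz zv; split=> //.
    by right; exact: (lin_le_lt_trans lt_lin) au uz.
  move=> w Pw yw wz; apply: yv => //.
  by right; exact: (lin_le_lt_trans lt_lin) wz zv.
- split; last by move=> x [_].
  split=> //; first by left.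
  (* As [y] is above [a], the condition defining the piece is void at [a]. *)
  move=> w Pw yw wa; case: (lin_irr lt_lin Py).
  exact: (lin_le_lt_trans lt_lin Py Pa) (lin_le_trans lt_lin Py Pw Pa yw wa) ay.
Qed.

End Pieces.

(** * Orders with simple semiintervals *)

Hypothesis lt_simple : simple_pair p lt.

(** The list [t] has one equivalence for each member of the cover with points above [a]: the one
    that determines the piece of such a point. *)
Lemma simple_levels_at a (X : set (tup M G)) : P a ->
  rel_definable_over p (A `|` entries a) X ->
  exists t, (forall E, List.In E t -> def_equivalence p E) /\
    forall y z, P y -> P z -> lt a y -> lt a z ->
      (forall E, List.In E t -> E a y <-> E a z) -> X y -> X z.
Proof.
move=> Pa dX; have [s [sC sP sX]] := homogeneous_cover dX.
have [t [tE tP]] : exists t, (forall E, List.In E t -> def_equivalence p E) /\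
    forall Y y, List.In Y s -> Y y -> lt a y -> exists2 E, List.In E t &
      forall z, P z -> lt a z -> E a z <-> piece a X y z.
  elim: s sC sX {sP} => [|Y s IH] sC sX; first by exists [::].
  have [||t [tE tP]] := IH.
  - by move=> Z sZ; apply: sC; right.
  - by move=> Z x y sZ; apply: sX; right.
  have YC := sC Y (or_introl erefl).
  have [[y0 [Yy0 ay0]]|nY] := pselect (exists y, Y y /\ lt a y); last first.
    exists t; split=> // Z y [ZY|sZ]; last exact: tP.
    by rewrite -ZY => Yy ay; case: nY; exists y.
  have Py0 : P y0 by exact: YC.1.
  have [E [dE pieceE]] := lt_simple (piece_semiinterval Pa dX Py0 ay0).
  exists (E :: t); split=> [F [<- //|/tE //]|Z y [<-|sZ] Zy ay].
    exists E; first by left.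
    move=> z Pz az; rewrite (piece_eq a YC _ Zy Yy0).
      by rewrite pieceE; split=> [Eaz|[]] //; split=> //; right.
    by move=> u v; apply: sX; left.
  by have [F tF FP] := tP Z y sZ Zy ay; exists F => //; right.
exists t; split=> // y z Py Pz ay az Eyz.
suff XE u v : P u -> P v -> lt a u -> lt a v -> lt u v ->
    (forall E, List.In E t -> E a u <-> E a v) -> X v <-> X u.
  have [yz|<- //|zy] := lin_total lt_lin Py Pz.
    by rewrite (XE y z).
  by rewrite (XE z y) // => E sE; rewrite Eyz.
move=> Pu Pv au av uv Euv; have [Y sY Yu] := sP u Pu.
have [E tE' EP] := tP Y u sY Yu au.
(* [u] is in its own piece, and equality of levels puts [v] there too. *)
have /EP[] // : E a v.
  apply/Euv => //; apply/EP => //; split=> //; first by right.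
  by move=> w Pw [<- //|uw] /(lin_ltNge lt_lin Pu Pw).1.
move=> _ _; apply=> //; [by right | by left].
Qed.

(** Automorphisms over [A] move [x] and [x'] to one point [a], so the list found at [a] serves for
    all increasing pairs. *)
Lemma simple_levels R : rel_definable_over2 p A R ->
  exists t, (forall E, List.In E t -> def_equivalence p E) /\
    forall x y x' y', P x -> P y -> P x' -> P y' -> lt x y -> lt x' y' ->
      (forall E, List.In E t -> E x y <-> E x' y') -> R x y -> R x' y'.
Proof.
move=> dR; have [[a Pa]|P0] := pselect (P !=set0); last first.
  by exists [::]; split=> // x y x' y' Px; case: P0; exists x.
have [t [tE tP]] := simple_levels_at Pa (rel_definable2_at dR Pa).
exists t; split=> // x y x' y' Px Py Px' Py' xy xy' Exy.
have [g [ag gA ga]] := realizations_conj Px Pa.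
have [h [ah hA ha]] := realizations_conj Px' Pa.
rewrite -(rel_definable2_aut ag gA dR Px Py) -(rel_definable2_aut ah hA dR Px' Py').
rewrite ga ha.
apply: tP.
- by rewrite realizations_aut.
- by rewrite realizations_aut.
- by rewrite -{1}ga lt_aut.
- by rewrite -{1}ha lt_aut.
move=> E sE; have dE := (tE E sE).2.
rewrite -{1}ga (rel_definable2_aut ag gA dE Px Py) -ha.
by rewrite (rel_definable2_aut ah hA dE Px' Py'); exact: Exy.
Qed.

End OnePair.

(** * Transfer to another weakly o-minimal order *)

Lemma simple_pair_transfer lt lt' : wom_pair p lt -> simple_pair p lt ->
  wom_pair p lt' -> simple_pair p lt'.
Proof.
move=> lt_wom lt_simple lt_wom' S a [[SP Sc] [Sa amin] dS].
have Pa := SP a Sa; have lin := wom_order lt_wom; have lin' := wom_order lt_wom'.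
have [R dR RS] := rel_definable_over_at dS.
(* Levels concern only pairs increasing for [lt]: points below [a] are handled by the converse of
   [R], and the levels of [lt'] tell the two [lt]-sides of [a] apart. *)
have [t1 [t1E t1P]] := simple_levels lt_wom lt_simple dR.
have [t2 [t2E t2P]] := simple_levels lt_wom lt_simple (rel_definable2_swap dR).
have [t3 [t3E t3P]] := simple_levels lt_wom lt_simple (wom_definable lt_wom').
(* Equality is the level that determines [S] when [S] is just its minimum. *)
pose t := eq :: t1 ++ t2 ++ t3.
have tE E : List.In E t -> def_equivalence p E.
  case=> [<-|/List.in_app_iff[/t1E //|/List.in_app_iff[/t2E //|/t3E //]]].
  exact: (def_equivalence_eq lt_wom).
have same_level y z : P y -> P z -> lt' a y -> lt' a z ->
    (forall E, List.In E t -> E a y <-> E a z) -> S y -> S z.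
  move=> Py Pz ay az Eyz; rewrite !RS //.
  have Esym E x : List.In E t -> P x -> E a x <-> E x a.
    by move=> /tE[[_ Es _] _] Px; split; exact: Es.
  have Eyz' E : List.In E t -> E y a <-> E z a.
    by move=> sE; rewrite -!Esym //; exact: Eyz.
  have s1 E : List.In E t1 -> List.In E t.
    by move=> sE; right; apply/List.in_app_iff; left.
  have s2 E : List.In E t2 -> List.In E t.
    by move=> sE; right; apply/List.in_app_iff; right; apply/List.in_app_iff; left.
  have s3 E : List.In E t3 -> List.In E t.
    by move=> sE; right; apply/List.in_app_iff; right; apply/List.in_app_iff; right.
  have [ya|ay0|ya] := lin_total lin Py Pa; last first.
  - have [za|az0|za] := lin_total lin Pz Pa; last first.
    + by apply: t1P => // E /s1; exact: Eyz.
    + by case: (lin_irr lin' Pa); rewrite -{2}az0.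
    (* The pairs [(a, y)] and [(z, a)] increase for [lt] and have the same levels, so [lt' a y]
       would give [lt' z a]. *)
    + have : lt' z a.
        apply: (t3P a y) => // E sE; rewrite -Esym //; last exact: s3.
        exact/Eyz/s3.
      by move/(lin_asym lin' Pz Pa).
  - by case: (lin_irr lin' Pa); rewrite -{2}ay0.
  have [za|az0|za] := lin_total lin Pz Pa.
  - by apply: t2P => // E /s2; exact: Eyz'.
  - by case: (lin_irr lin' Pa); rewrite -{2}az0.
  have : lt' y a.
    apply: (t3P a z) => // E sE; rewrite -Esym //; last exact: s3.
    by rewrite Eyz //; exact: s3.
  by move/(lin_asym lin' Py Pa).
have convE E y z : List.In E t -> P y -> P z -> lt' a y -> le_of lt' y z ->
    E a z -> E a y.
  by move=> sE Py Pz ay [<- //|yz] Eaz; apply: (def_equivalence_convex lt_wom' (tE E sE)) ay yz.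
(* [y] is a point of [S] far enough to leave every class of [a] that does not contain all of [S]. *)
have [y [Sy yE]] : exists y, S y /\
    forall E, List.In E t -> E a y -> forall z, S z -> E a z.
  have : forall E, List.In E t -> List.In E t by [].
  elim: {1 3}t => [|F s IH] st; first by exists a.
  have [|y [Sy yE]] := IH; first by move=> E sE; apply: st; right.
  have tF : List.In F t by apply: st; left.
  have [FS|nFS] := pselect (F a y -> forall z, S z -> F a z).
    by exists y; split=> // E [<-|] //; exact: yE.
  move/not_implyP: nFS => [Fay /existsNP[z /not_implyP[Sz nFaz]]].
  (* By convexity of the class for [F], the new point [z] lies beyond [y], so it also avoids the
     earlier classes that [y] avoided. *)
  exists z; split=> // E [<- //|sE] Eaz; apply: yE => //.
  have [Py Pz] := (SP _ Sy, SP _ Sz).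
  have [<-|ay] := amin y Sy; first by have [[Er _ _] _] := tE _ (st _ (or_intror sE)); exact: Er.
  apply: (convE E y z) => //; first by apply: st; right.
  apply: contrapT => nyz; apply: nFaz.
  have [<-|az] := amin z Sz; first by have [[Fr _ _] _] := tE F tF; exact: Fr.
  apply: (convE F z y) => //; right.
  exact: ((lin_ltNge lin' Pz Py).2 nyz).
(* By the choice of [y], the selected [E] are exactly those in [t] whose class of [a] contains
   [S]. *)
exists (fun u v => forall E, List.In E t -> E a y -> E u v); split.
  exact: (def_equivalence_all (fun E => E a y)).
have Py := SP y Sy.
apply/seteqP; split=> [z Sz|z [Pz Eaz az]] /=.
  by split; [exact: SP | move=> E tE' Eay; exact: yE | exact: amin].
case: az => [<- //|az].
(* Either [z] and [y] have the same levels, or some class of [a] contains [z] but not [y]; then [z]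
   precedes [y] and lies in [S] by convexity. *)
have [Ez|nEz] := pselect (forall E, List.In E t -> E a z -> E a y).
  have [ay|ay] := amin y Sy.
    by rewrite -(Eaz eq (or_introl erefl) ay).
  by apply: (same_level y) => // E tE'; split; [exact: Eaz | exact: Ez].
have [F [tF Faz nFay]] : exists F, [/\ List.In F t, F a z & ~ F a y].
  move/existsNP: nEz => [F /not_implyP[tF /not_implyP[Faz nFay]]].
  by exists F.
apply: (Sc a y) => //; apply/(lin_ltNge lin') => // yz; apply: nFay.
have [<-|ay] := amin y Sy; first by have [[Er _ _] _] := tE F tF; exact: Er.
exact: (convE F y z).
Qed.

End WeaklyOMinimalTypes.

Theorem corollary2p14 (L : language) (T : theory L) (hT : complete_theory T)
    (K : Type) (C : structure L) (hC : monster K T C)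
    (A : set (elt C)) (hA : small K A)
    (G : seq (sorts L)) (p : set (pformula A G))
    (hp : complete_type p) (hw : wom_type p) :
  simple_type p <-> exists lt, wom_pair p lt /\ simple_pair p lt.
Proof.
split=> [sp|[lt [lt_wom lt_simple]] lt' lt_wom'].
  by case: hw => lt lt_wom; exists lt; split=> //; exact: sp.
exact: (simple_pair_transfer (monster_infinite hC) (monster_saturated hC)
  (monster_homogeneous hC) hA hp lt_wom lt_simple lt_wom').
Qed.
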